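(* The characteristic polynomial $P_n(x)=\det(xI-J_n)$ of the $n\times n$ matrix $J_n$ described in the context satisfies the recursive equation $$P_n(x)=\left[\left(\frac{1}{\alpha_n}+\frac{1}{\alpha_{n-1}}\right)x-1-\frac{(\alpha_n-1)^2}{4\alpha_n}-\frac{(\alpha_{n-1}-1)^2}{4\alpha_{n-1}}\right]P_{n-1}(x)-\left[\frac{(\alpha_{n-1}-1)^2}{4\alpha_{n-1}}-\frac{\alpha_{n-1}-1}{2}-\frac{1}{\alpha_{n-1}}x\right]^2P_{n-2}(x),$$ with initial conditions $P_0(x)=1$ and $P_1(x)=\frac{x}{\alpha_1}-\frac{(\alpha_1+1)^2}{4\alpha_1}$.
   Context: For real parameters $\alpha_1,\ldots,\alpha_n$, define $J_n=U_nV_n\in\mathbb{R}^{n\times n}$, where $U_n$ is the upper triangular matrix with entries $(U_n)_{ii}=\frac{\alpha_i+1}{2}$, $(U_n)_{ij}=\alpha_j$ for $i<j$, and $(U_n)_{ij}=0$ for $i>j$; and $V_n$ is the lower triangular matrix with entries $(V_n)_{ii}=\frac{\alpha_i+1}{2}$, $(V_n)_{ij}=\alpha_j$ for $i>j$, and $(V_n)_{ij}=0$ for $i<j$. $I$ denotes the $n\times n$ identity matrix.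
   Formalization: P_n(x) is taken as det(xI − J_n) divided by α_1⋯α_n, with all α_i nonzero, because the monic det(xI − J_n) contradicts the stated P_1 (for α_1 = 2 it is x − 9/4, not x/2 − 9/8) and the recursion. *)

(* Defs.v *)
(* MathComp *)
From HB Require Import structures.
From mathcomp Require Import all_boot all_order all_algebra.

Set Implicit Arguments.
Unset Strict Implicit.
Unset Printing Implicit Defensive.

Import Order.TTheory GRing.Theory Num.Theory.
Local Open Scope ring_scope.

(* The parameters alpha_1, alpha_2, ... are the values alpha 1, alpha 2, ...
   (alpha 0 is never used), while matrix indices start at 0: row or column
   i : 'I_n carries the parameter alpha i.+1. *)

Definition U_mx (R : realFieldType) (alpha : nat -> R) (n : nat) : 'M[R]_n :=
  \matrix_(i < n, j < n)
    if i == j then (alpha i.+1 + 1) / 2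
    else if (i < j)%N then alpha j.+1 else 0.

Definition V_mx (R : realFieldType) (alpha : nat -> R) (n : nat) : 'M[R]_n :=
  \matrix_(i < n, j < n)
    if i == j then (alpha i.+1 + 1) / 2
    else if (j < i)%N then alpha j.+1 else 0.

Definition J_mx (R : realFieldType) (alpha : nat -> R) (n : nat) : 'M[R]_n :=
  U_mx alpha n *m V_mx alpha n.

(* The characteristic polynomial det(xI - J_n), scaled by the constant
   1 / (alpha_1 ... alpha_n).  The scaling is the one that the initial condition
   P_1(x) = x / alpha_1 - (alpha_1 + 1)^2 / (4 alpha_1) forces for n = 1, since
   det(xI - J_1) = x - (alpha_1 + 1)^2 / 4; the monic polynomials themselves
   do not satisfy the recursion. *)
Definition P_poly (R : realFieldType) (alpha : nat -> R) (n : nat) : {poly R} :=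
  (\prod_(1 <= i < n.+1) alpha i)^-1 *: char_poly (J_mx alpha n).

(* Main.v *)
Require Import Defs.
From mathcomp Require Import all_boot all_order all_algebra.
From mathcomp Require Import ring.

Set Implicit Arguments.
Unset Strict Implicit.
Unset Printing Implicit Defensive.

Import Order.TTheory GRing.Theory Num.Theory.
Local Open Scope ring_scope.

(** The determinant of [x I - J_n] obeys a first-order two-term recursion once
    it is paired with a companion quantity.  Write [M_n = x I - J_n], let [1]
    be the all-ones column and [v_n] the row of parameters
    [alpha_1, ..., alpha_n], and put [p_n = det M_n] and
    [q_n = v_n adj(M_n) 1].  With [a = alpha_(n+1)], [d = (a + 1) / 2] and
    [e = (a - 1) / 2], the bordered form of [U] and [V] gives
    [[
      J_(n+1) = [ J_n + a 1 v_n   a d 1 ]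
                [ d v_n           d^2   ]
    ]]
    so [M_(n+1)] is [M_n] perturbed and bordered only by multiples of [1] and
    [v_n].  The determinant of any such matrix is a combination of [p_n] and
    [q_n] ([det_bordered]), and this yields ([det_charJ_recr],
    [borderJ_recr])
    [[
      p_(n+1) = (x - d^2) p_n - a x q_n,
      q_(n+1) = a p_n + (x - e^2) q_n.
    ]]
    Eliminating [q] from two consecutive steps leaves a three-term recursion
    for [p].  After division by [alpha_1 ... alpha_n], the coefficient of
    [P_(n-1)] is [(x - d_n^2) / alpha_n + (x - e_(n-1)^2) / alpha_(n-1)], and
    that of [P_(n-2)] is minus the determinant of the step matrix,
    [(x - d^2)(x - e^2) / a^2 + x] at [a = alpha_(n-1)].  This determinant is
    a perfect square, [((x + (a^2 - 1) / 4) / a)^2], which is the square in the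
    statement. *)

Section BorderedDet.
Variables (R : comNzRingType) (n : nat).
Implicit Types (M : 'M[R]_n) (w : 'cV[R]_n) (v : 'rV[R]_n).

(** This is the only entry of [v *m \adj M *m w].  It is written as a bordered
    determinant so that block row and column operations apply to it. *)
Definition border M w v : R := - \det (block_mx M w v (0 : 'M_1)).

(** The determinant is linear in the last row [(v, z) = (0, z) + (v, 0)]. *)
Lemma det_corner M w v (z : R) :
  \det (block_mx M w v z%:M) = z * \det M - border M w v.
Proof.
rewrite /border opprK.
have -> : z * \det M = \det (block_mx M w 0 (z%:M : 'M_1)).
  by rewrite det_ublock det_scalar1 mulrC.
have row'_eq (r1 r2 : 'rV[R]_n) (s1 s2 : 'M[R]_1) :
    row' (rshift n ord0) (block_mx M w r1 s1)
    = row' (rshift n ord0) (block_mx M w r2 s2).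
  apply/matrixP=> i j; rewrite !mxE.
  case: splitP=> // k /eqP; rewrite (ord1 k) => /eqP ik.
  by have /eqP := neq_lift (rshift n ord0) i; case; apply: val_inj.
rewrite (determinant_multilinear
  (B := block_mx M w 0 (z%:M : 'M_1)) (C := block_mx M w v (0 : 'M_1))
  (i0 := rshift n ord0) (b := 1) (c := 1)) ?mul1r //.
apply/rowP=> j; rewrite !mxE.
case: splitP=> [k /= kE|k _]; first by have := ltn_ord k; rewrite -kE addn0 ltnn.
by rewrite !mxE; case: (split j)=> k'; rewrite !mxE; ring.
Qed.

Lemma border_scale M w v (t k c : R) :
  border (M + t *: (w *m v)) (c *: w) (k *: v) = k * c * border M w v.
Proof.
rewrite /border.
have -> : block_mx (M + t *: (w *m v)) (c *: w) (k *: v) (0 : 'M_1)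
   = block_mx 1%:M (t *: w) 0 k%:M *m block_mx M w v 0
     *m block_mx 1%:M 0 0 c%:M.
  by rewrite !mulmx_block !(mulmx1, mul1mx, mulmx0, mul0mx, addr0, add0r,
    mul_scalar_mx, mul_mx_scalar, scaler0, scalemxAl).
by rewrite !det_mulmx !det_ublock !det1 !det_scalar1; ring.
Qed.

(** The matrix determinant lemma, without inverting [M]. *)
Lemma det_rank1 M w v (t : R) :
  \det (M + t *: (w *m v)) = \det M + t * border M w v.
Proof.
(* A unipotent row operation trades the rank-one term for a border. *)
have /(congr1 determinant) :
    block_mx 1%:M (t *: w) 0 1%:M *m block_mx M (- t *: w) v (1%:M : 'M_1)
    = block_mx (M + t *: (w *m v)) 0 v 1%:M.
  rewrite !mulmx_block !(mulmx1, mul1mx, mulmx0, mul0mx, add0r).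
  by rewrite scaleNr addNr scalemxAl.
rewrite det_mulmx det_ublock det_lblock !det1 !mul1r mulr1 => <-.
rewrite det_corner mul1r.
by have := border_scale M w v 0 1 (- t); rewrite scale0r addr0 scale1r => ->; ring.
Qed.

(** When the perturbation and the border of [M] use the same [w] and [v], the
    determinant stays in the span of [\det M] and [border M w v]; this is what
    closes the recursion after two quantities. *)
Lemma det_bordered M w v (t k c z : R) :
  \det (block_mx (M + t *: (w *m v)) (c *: w) (k *: v) z%:M)
  = z * \det M + (z * t - k * c) * border M w v.
Proof. by rewrite det_corner det_rank1 border_scale; ring. Qed.

End BorderedDet.

Section Recursion.
Variables (R : realFieldType) (alpha : nat -> R).

Definition ones (n : nat) : 'cV[R]_n := const_mx 1.
Definition params (n : nat) : 'rV[R]_n := \row_j alpha j.+1.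
Definition charJ (n : nat) (x : R) : 'M[R]_n := x%:M - J_mx alpha n.
Definition borderJ (n : nat) (x : R) : R :=
  border (charJ n x) (ones n) (params n).

Lemma horner_char_polyJ n (x : R) :
  (char_poly (J_mx alpha n)).[x] = \det (charJ n x).
Proof.
rewrite /char_poly -horner_evalE -det_map_mx; congr (\det _).
apply/matrixP=> i j; rewrite !mxE /= horner_evalE hornerD hornerN hornerC.
by rewrite hornerMn hornerX.
Qed.

Lemma U_mx_recr n :
  U_mx alpha (n + 1) =
  block_mx (U_mx alpha n) (alpha n.+1 *: ones n) 0 ((alpha n.+1 + 1) / 2)%:M.
Proof.
apply/matrixP=> i j; rewrite !mxE.
case: splitP=> i' iE; rewrite !mxE; case: splitP=> j' jE;
  rewrite !mxE -!val_eqE /= iE jE //.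
- by rewrite (ord1 j') addn0 mulr1 ltn_ord (ltn_eqF (ltn_ord i')).
- by rewrite (ord1 i') addn0 (gtn_eqF (ltn_ord j')) ltnNge ltnW.
- by rewrite (ord1 i') (ord1 j') addn0 !eqxx.
Qed.

Lemma V_mx_recr n :
  V_mx alpha (n + 1) =
  block_mx (V_mx alpha n) 0 (params n) ((alpha n.+1 + 1) / 2)%:M.
Proof.
apply/matrixP=> i j; rewrite !mxE.
case: splitP=> i' iE; rewrite !mxE; case: splitP=> j' jE;
  rewrite !mxE -!val_eqE /= iE jE //.
- by rewrite (ord1 j') addn0 (ltn_eqF (ltn_ord i')) ltnNge ltnW.
- by rewrite (ord1 i') addn0 (gtn_eqF (ltn_ord j')) ltn_ord.
- by rewrite (ord1 i') (ord1 j') addn0 !eqxx.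
Qed.

Lemma J_mx_recr n (a := alpha n.+1) (d := (a + 1) / 2) :
  J_mx alpha (n + 1) =
  block_mx (J_mx alpha n + a *: (ones n *m params n)) ((a * d) *: ones n)
           (d *: params n) (d ^+ 2)%:M.
Proof.
rewrite /J_mx U_mx_recr V_mx_recr mulmx_block !(mulmx0, mul0mx, add0r).
by rewrite mul_scalar_mx mul_mx_scalar -scalar_mxM scalerA -scalemxAl mulrC.
Qed.

(** One shift parameter [s] serves both members of the recursion: [s = 0] is
    the determinant itself, and [s = 1] gives the border by [det_rank1]. *)
Lemma det_charJ_shift n (x s : R) (a := alpha n.+1) (d := (a + 1) / 2) :
  \det (charJ (n + 1) x - s *: (ones (n + 1) *m params (n + 1))) =
  (x - d ^+ 2 - s * a) * \det (charJ n x)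
  - ((x - d ^+ 2 - s * a) * (a + s) + (d + s) * (a * d + s * a))
    * borderJ n x.
Proof.
have onesE : ones (n + 1) = col_mx (ones n) 1%:M.
  apply/matrixP=> i j; rewrite !mxE; case: splitP=> k _; rewrite !mxE //.
  by rewrite !ord1.
have paramsE : params (n + 1) = row_mx (params n) a%:M.
  apply/matrixP=> i j; rewrite !mxE; case: splitP=> k jE; rewrite !mxE jE //.
  by rewrite !ord1 addn0.
have -> : charJ (n + 1) x - s *: (ones (n + 1) *m params (n + 1)) =
    block_mx (charJ n x + (- (a + s)) *: (ones n *m params n))
             ((- (a * d + s * a)) *: ones n) ((- (d + s)) *: params n)
             (x - d ^+ 2 - s * a)%:M.
  rewrite /charJ J_mx_recr onesE paramsE mul_col_row -/a -/d.
  rewrite scalar_mx_block scale_block_mx !opp_block_mx !add_block_mx.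
  rewrite !(mul1mx, mul_mx_scalar) !sub0r.
  congr block_mx.
  - by rewrite opprD addrA scaleNr scalerDl opprD !addrA.
  - by rewrite scaleNr scalerDl opprD scalerA.
  - by rewrite scaleNr scalerDl opprD.
  - by rewrite scale_scalar_mx -!raddfB.
by rewrite det_bordered -/(borderJ n x); ring.
Qed.

Lemma det_charJ_recr n (x : R) (a := alpha n.+1) :
  \det (charJ n.+1 x) =
  (x - ((a + 1) / 2) ^+ 2) * \det (charJ n x) - a * x * borderJ n x.
Proof.
have := det_charJ_shift n x 0; rewrite scale0r subr0 -/a addn1 => ->.
by field.
Qed.

Lemma borderJ_recr n (x : R) (a := alpha n.+1) :
  borderJ n.+1 x = a * \det (charJ n x) + (x - ((a - 1) / 2) ^+ 2) * borderJ n x.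
Proof.
have := det_charJ_shift n x 1.
rewrite -scaleNr det_rank1 -/(borderJ (n + 1) x) addn1 det_charJ_recr -/a.
move=> /(canRL (addKr _)); rewrite mulN1r => /(canRL opprK) ->.
by field.
Qed.

Lemma borderJ0 x : borderJ 0 x = 0.
Proof.
rewrite /borderJ /border (_ : block_mx _ _ _ _ = 0) ?det0 ?oppr0 //.
by apply/matrixP=> i j; rewrite !mxE;
  do 2![case: splitP => [[]|] //= ? _; rewrite !mxE].
Qed.

Lemma horner_P_poly n (x : R) :
  (P_poly alpha n).[x] = (\prod_(1 <= i < n.+1) alpha i)^-1 * \det (charJ n x).
Proof. by rewrite hornerZ horner_char_polyJ. Qed.

End Recursion.

Theorem proposition2p1 (R : realFieldType) (N : nat) (alpha : nat -> R)
    (alpha_neq0 : forall i : nat, (1 <= i <= N)%N -> alpha i != 0) :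
  [/\ forall x : R, (P_poly alpha 0).[x] = 1,
      (1 <= N)%N -> forall x : R,
        (P_poly alpha 1).[x]
        = x / alpha 1%N - (alpha 1%N + 1) ^+ 2 / (4 * alpha 1%N)
    & forall n : nat, (2 <= n <= N)%N -> forall x : R,
        (P_poly alpha n).[x]
        = (((alpha n)^-1 + (alpha n.-1)^-1) * x - 1
             - (alpha n - 1) ^+ 2 / (4 * alpha n)
             - (alpha n.-1 - 1) ^+ 2 / (4 * alpha n.-1))
            * (P_poly alpha n.-1).[x]
          - ((alpha n.-1 - 1) ^+ 2 / (4 * alpha n.-1)
               - (alpha n.-1 - 1) / 2
               - (alpha n.-1)^-1 * x) ^+ 2
            * (P_poly alpha n.-2).[x]].
Proof.
split=> [x|N_gt0 x|[|[|n]] // /andP[_ le_n2N] x].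
- by rewrite horner_P_poly big_geq // det_mx00 invr1 mulr1.
- have a_neq0 : alpha 1%N != 0 by apply: alpha_neq0.
  rewrite horner_P_poly big_nat1 det_charJ_recr det_mx00 borderJ0.
  by field.
have a_neq0 : alpha n.+1 != 0 by apply: alpha_neq0; exact: ltnW.
have b_neq0 : alpha n.+2 != 0 by apply: alpha_neq0.
rewrite /= !horner_P_poly.
rewrite (big_nat_recr n.+2) // (big_nat_recr n.+1) //=.
have : \prod_(1 <= i < n.+1) alpha i != 0.
  rewrite prodf_seq_neq0; apply/allP=> i.
  rewrite mem_index_iota => /andP[i_gt0 lt_in].
  by apply: alpha_neq0; rewrite i_gt0 (leq_trans _ (ltnW le_n2N)) // ltnW.
move: (\prod_(1 <= i < n.+1) alpha i) => c c_neq0.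
(* Elimination of the border without dividing by [x]: both sides become
   combinations of the determinant and the border of size [n]. *)
rewrite (det_charJ_recr _ n.+1) borderJ_recr det_charJ_recr.
by field; rewrite ?a_neq0 ?b_neq0 ?c_neq0.
Qed.
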